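(* The following hold: $$\mathrm{Tr}[Pe^{i\epsilon\mathcal P}]=\mathrm{tr}[\mathbb 1].$$ For all $t_1,t_2\in\{0,\dots,N-1\}$ and all $i,j\in\{1,\dots,L\}$, $$\mathrm{Tr}\big[Pe^{i\epsilon\mathcal P}a_{t_1i}a^\dagger_{t_2j}\big]=\begin{cases}\mathrm{tr}[a_ia_j^\dagger], & t_1\ge t_2,\\ -\mathrm{tr}[a_j^\dagger a_i], & t_1<t_2.\end{cases}$$ Moreover, for all $t_1,t_2,i,j$, $$\mathrm{Tr}\big[Pe^{i\epsilon\mathcal P}a_{t_1i}a_{t_2j}\big]=0,\qquad \mathrm{Tr}\big[Pe^{i\epsilon\mathcal P}a^\dagger_{t_1i}a^\dagger_{t_2j}\big]=0.$$
   Context: Fix integers $L\ge1$, $N\ge1$, a real $\epsilon>0$, and set $T=\epsilon N$. The space $h$. Let $h$ be the fermionic Fock space of $L$ modes ($\dim h=2^L$), with vacuum $|0\rangle$ and ladder operators $a_i$ satisfying $\{a_i,a_j^\dagger\}=\delta_{ij}$ and $\{a_i,a_j\}=\{a_i^\dagger,a_j^\dagger\}=0$. The symbol $\mathrm{tr}$ is the trace on $h$. The space $\mathcal H$. Let $\mathcal H$ ($\dim\mathcal H=2^{LN}$) be the Fock space generated from a vacuum $|\Omega\rangle$ by $a_{ti}$, $t=0,\dots,N-1$, $i=1,\dots,L$, with $\{a_{ti},a^\dagger_{t'j}\}=\delta_{tt'}\delta_{ij}$ and $\{a_{ti},a_{t'j}\}=\{a^\dagger_{ti},a^\dagger_{t'j}\}=0$.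 The symbol $\mathrm{Tr}$ is the trace on $\mathcal H$. Time translations and parity. Set $\omega_n=(2n+1)\pi/T$ and $\hat a_{ni}=N^{-1/2}\sum_{t=0}^{N-1}e^{i\omega_n\epsilon t}a_{ti}$ for $n=0,\dots,N-1$. Define $$\mathcal P=\sum_{n,j}\omega_n\hat a^\dagger_{nj}\hat a_{nj},\qquad P=\exp\Big(i\pi\sum_{t,i}a^\dagger_{ti}a_{ti}\Big)$$ (the parity operator). *)

(* Defs.v *)
From mathcomp Require Import all_boot all_order all_algebra.
From mathcomp Require Import all_classical all_reals all_analysis.
From mathcomp Require Import complex.
Set Implicit Arguments. Unset Strict Implicit. Unset Printing Implicit Defensive.
Import Order.TTheory GRing.Theory Num.Theory.
Import numFieldNormedType.Exports.
Local Open Scope ring_scope.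
Local Open Scope complex_scope.

Section Fock.
Variable R : realType.
Local Notation C := (R[i]).

(* Matrix exponential, defined entrywise by the exponential power series
   exp A = lim_K \sum_(k<K) A^k / k!  (limit taken in C with its norm topology). *)
Definition mexp (n : nat) (A : 'M[C]_n) : 'M[C]_n :=
  \matrix_(r, c) limn (fun K : nat =>
     ((\sum_(k < K) (k`!%:R)^-1 *: A ^+ k) r c : C^o)).

(* Hermitian adjoint *)
Definition adj (n : nat) (A : 'M[C]_n) : 'M[C]_n := map_mx (fun z => z^*) A^T.

(* e^{i theta} *)
Definition expi (theta : R) : C := cos theta +i* sin theta.

(* occupation number of mode m in the basis state labelled by k < 2^M *)
Definition bit (k m : nat) : bool := odd (k %/ 2 ^ m).

(* Fermionic Fock space of M modes realised as C^(2^M) with the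
   Jordan-Wigner annihilation operator of mode m (0-based):
   a_m |n> = (-1)^{n_0+...+n_{m-1}} n_m |n - e_m>. *)
Definition fann (M m : nat) : 'M[C]_(2 ^ M) :=
  \matrix_(r, c)
    if bit c m && (nat_of_ord r == (nat_of_ord c - 2 ^ m)%N)
    then (-1) ^+ (\sum_(l < m) bit c l)%N else 0.

(* the space h: modes i = 0..L-1 (paper's 1..L) *)
Definition a_h (L : nat) (i : 'I_L) : 'M[C]_(2 ^ L) := fann L i.

(* the space H: modes (t,i), t < N, i < L, numbered t*L + i *)
Definition a_H (L N : nat) (t : 'I_N) (i : 'I_L) : 'M[C]_(2 ^ (L * N)) :=
  fann (L * N) (t * L + i).

(* omega_n = (2n+1) pi / T, T = eps N *)
Definition omega (N : nat) (eps : R) (n : nat) : R :=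
  (2 * n%:R + 1) * pi / (eps * N%:R).

(* \hat a_{n j} = N^{-1/2} \sum_t e^{i omega_n eps t} a_{t j} *)
Definition ahat (L N : nat) (eps : R) (n : nat) (j : 'I_L) : 'M[C]_(2 ^ (L * N)) :=
  ((Num.sqrt (N%:R : R))^-1)%:C *:
    \sum_(t < N) expi (omega N eps n * eps * t%:R) *: a_H t j.

(* \mathcal P = \sum_{n,j} omega_n \hat a^dag_{nj} \hat a_{nj} *)
Definition Pcal (L N : nat) (eps : R) : 'M[C]_(2 ^ (L * N)) :=
  \sum_(n < N) \sum_(j < L)
     (omega N eps n)%:C *: (adj (ahat N eps n j) *m ahat N eps n j).

(* parity operator P = exp(i pi \sum_{t,i} a^dag_{ti} a_{ti}) *)
Definition parity (L N : nat) : 'M[C]_(2 ^ (L * N)) :=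
  mexp ((0 +i* pi) *: \sum_(t < N) \sum_(i < L) (adj (a_H t i) *m a_H t i)).

End Fock.

(* Main.v *)
(* The discrete Fourier transform diagonalises time translation: with z_n = e^{i omega_n eps}, an
   N-th root of -1, the operator U = P e^{i eps Pcal} is the product over the Fourier modes of
   1 - (1 + z_n) n_{nj}, where n_{nj} is the occupation number, so Tr U = prod_n (1 - z_n)^L = 2^L.
   Conjugation by U multiplies each mode by a phase different from 1, which kills the anomalous
   correlators, and shifts time by one step with a sign: a_{t+1} U = - U a_t and a_0 U = U a_{N-1}.
   Combined with cyclicity of the trace and the anticommutation relations, G(t) = Tr[U a_t a_u^+]
   is constant in t except for a jump by delta_ij Tr U at t = u, and G(0) = - G(N-1) whenever u > 0;
   hence G = +- delta_ij 2^L / 2. *)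
Require Import Defs.
From mathcomp Require Import all_boot all_order all_algebra.
From mathcomp Require Import all_classical all_reals all_analysis.
From mathcomp Require Import complex.
From mathcomp Require Import zify ring lra.
Set Implicit Arguments. Unset Strict Implicit. Unset Printing Implicit Defensive.
Import Order.TTheory GRing.Theory Num.Theory.
Import numFieldNormedType.Exports.
Local Open Scope classical_set_scope.
Local Open Scope ring_scope.
Local Open Scope complex_scope.

(** * Jordan-Wigner operators *)

(** Creation and annihilation both act on labels by toggling one bit, so a single involution serves
    both and keeps truncated subtraction out of later arguments. *)
Definition flip (m k : nat) : nat :=
  (if bit k m then k - 2 ^ m else k + 2 ^ m)%N.

Lemma bitS (k m : nat) : bit k m.+1 = bit k./2 m.
Proof. by rewrite /bit expnS divnMA divn2. Qed.

Lemma bit_le (k m : nat) : bit k m -> (2 ^ m <= k)%N.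
Proof.
rewrite /bit; case: (leqP (2 ^ m) k) => // lt_k.
by rewrite divn_small.
Qed.

Lemma flipS (m k : nat) : flip m.+1 k = (odd k + (flip m k./2).*2)%N.
Proof.
rewrite /flip bitS expnS; have := odd_double_half k.
by case: ifP => [/bit_le|_]; lia.
Qed.

(** With [bit_inj], this reduces every identity between flipped labels to Boolean arithmetic on
    bits; the induction strips the lowest bit. *)
Lemma bit_flip (m k l : nat) : bit (flip m k) l = bit k l (+) (l == m).
Proof.
elim: m k l => [|m IHm] k [|l].
- rewrite /flip /bit expn0 !divn1 /=.
  by case: ifP; lia.
- rewrite !bitS addbF; congr bit.
  by rewrite /flip /bit expn0 divn1; case: ifP; lia.
- by rewrite flipS /bit expn0 !divn1 oddD odd_double oddb !addbF.
- rewrite flipS !bitS eqSS -IHm; congr bit.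
  by rewrite halfD doubleK odd_double; case: (odd k).
Qed.

Lemma bit_inj (k k' : nat) : (forall l, bit k l = bit k' l) -> k = k'.
Proof.
have [n] := ubnP (maxn k k'); elim: n k k' => // n IHn k k' lt_n eq_bit.
have := eq_bit 0%N; rewrite /bit expn0 !divn1 => eq_odd.
have [k0 | k_gt0] := posnP (maxn k k'); first by lia.
rewrite -(odd_double_half k) -(odd_double_half k') eq_odd; congr (_ + _.*2)%N.
by apply: IHn => [|l]; [lia | rewrite -!bitS].
Qed.

Lemma flip_lt (M m k : nat) : (m < M)%N -> (k < 2 ^ M)%N -> (flip m k < 2 ^ M)%N.
Proof.
elim: M m k => // M IHM [|m] k lt_m lt_k.
  rewrite /flip /bit expn0 divn1; move: lt_k; rewrite expnS.
  by case: ifP; lia.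
rewrite flipS expnS.
have : (flip m k./2 < 2 ^ M)%N by apply: IHM => //; move: lt_k; rewrite expnS; lia.
by case: (odd k); lia.
Qed.

Lemma flipK (m : nat) : involutive (flip m).
Proof. by move=> k; apply: bit_inj => l; rewrite !bit_flip -addbA addbb addbF. Qed.

Lemma flipC (m l k : nat) : flip m (flip l k) = flip l (flip m k).
Proof. by apply: bit_inj => i; rewrite !bit_flip addbAC. Qed.

Definition jw_sign (R : realType) (m k : nat) : R[i] :=
  (-1) ^+ (\sum_(l < m) bit k l)%N.

(** The Jordan-Wigner sign sees only the bits below [m], so toggling bit [l] matters exactly when
    [l < m]. Anticommutation of distinct modes comes from this asymmetry. *)
Lemma jw_sign_flip (R : realType) (m l k : nat) :
  jw_sign R m (flip l k) = jw_sign R m k * (-1) ^+ (l < m)%N.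
Proof.
have -> : (l < m)%N = (\sum_(j < m) (j == l :> nat))%N :> nat.
  elim: m => [|m IHm]; first by rewrite big_ord0.
  by rewrite big_ord_recr /= -IHm; lia.
rewrite /jw_sign !expr_sum -big_split /=; apply: eq_bigr => j _.
by rewrite bit_flip signr_addb.
Qed.

Lemma jw_sign_sq (R : realType) (m k : nat) : jw_sign R m k * jw_sign R m k = 1.
Proof. by rewrite /jw_sign -expr2 sqrr_sign. Qed.

(* Annihilation ([p = true]) and creation ([p = false]) operators at once. *)
Definition ladder (R : realType) (M : nat) (p : bool) (m : nat) : 'M[R[i]]_(2 ^ M) :=
  \matrix_(r, c) if (bit c m == p) && (r == flip m c :> nat) then jw_sign R m c else 0.

Lemma fannE (R : realType) (M m : nat) : fann R M m = ladder R M true m.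
Proof.
apply/matrixP => r c; rewrite !mxE eqb_id /flip.
by case: (bit c m).
Qed.

Lemma adj_fannE (R : realType) (M m : nat) : adj (fann R M m) = ladder R M false m.
Proof.
apply/matrixP => r c; rewrite fannE !mxE.
have -> : (bit r m == true) && (c == flip m r :> nat) =
          (bit c m == false) && (r == flip m c :> nat).
  (* Transposition exchanges the two labels; since [flip m] is an involution that changes bit [m],
     the required occupation turns from [true] to [false]. *)
  apply/andP/andP => -[/eqP bE /eqP kE]; rewrite kE flipK bit_flip eqxx /=.
    by rewrite bE.
  by rewrite bE.
case: ifP => [/andP[_ /eqP ->]|_]; last by rewrite /= oppr0.
by rewrite jw_sign_flip ltnn mulr1 /jw_sign rmorph_sign.
Qed.

(** A column of a ladder operator has at most one nonzero entry, so only the intermediate state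
    [flip l c] contributes to the product. *)
Lemma ladder_mul (R : realType) (M : nat) (p q : bool) (m l : nat) (r c : 'I_(2 ^ M)) :
  (l < M)%N ->
  (ladder R M p m *m ladder R M q l) r c =
    if [&& bit c l == q, bit c m (+) (m == l) == p & r == flip m (flip l c) :> nat]
    then jw_sign R m c * jw_sign R l c * (-1) ^+ (l < m)%N else 0.
Proof.
move=> lt_l; pose k : 'I_(2 ^ M) := Ordinal (flip_lt lt_l (ltn_ord c)).
rewrite mxE (bigD1 k) //= big1 ?addr0 => [|j neq_j]; last first.
  rewrite !mxE [X in _ * X]ifF ?mulr0 //.
  by apply/negbTE; rewrite negb_and -(inj_eq val_inj) in neq_j *; rewrite neq_j orbT.
rewrite !mxE /= eqxx andbT bit_flip.
case: (bit c l == q); last by rewrite mulr0.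
case: ifP => _; last by rewrite mul0r.
by rewrite jw_sign_flip mulrAC.
Qed.

(** For equal modes, [p != q] lets exactly one ordering survive on each basis state, and [p = q]
    lets none. For distinct modes both orderings reach the same state, and exactly one of [l < m],
    [m < l] supplies a sign. *)
Lemma ladder_anticomm (R : realType) (M : nat) (p q : bool) (m l : nat) :
  (m < M)%N -> (l < M)%N ->
  ladder R M p m *m ladder R M q l + ladder R M q l *m ladder R M p m =
    (((m == l) && (p != q))%:R)%:M.
Proof.
move=> lt_m lt_l; apply/matrixP => r c; rewrite mxE !ladder_mul // mxE.
have [<-{l lt_l}|neq_ml] := eqVneq m l.
  rewrite flipK ltnn jw_sign_sq mulr1 (inj_eq val_inj).
  by case: (bit c m) p q (r == c) => -[] [] [] //=; rewrite ?addr0 ?add0r ?mulr0n ?mulr1n.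
rewrite (flipC l) /= mul0rn !addbF.
case: (r == _ :> nat); last by rewrite !andbF addr0.
case: (_ == p); case: (_ == q); rewrite /= ?addr0 //.
rewrite [jw_sign R l c * _]mulrC -mulrDr.
have [lt_ml|lt_lm|eq_ml] := ltngtP m l; last by rewrite eq_ml eqxx in neq_ml.
  by rewrite expr0 expr1 addrN mulr0.
by rewrite expr0 expr1 addNr mulr0.
Qed.

(** * Exponentials of sums of commuting idempotents *)

Definition mexp_psum (R : realType) (n : nat) (A : 'M[R[i]]_n) (K : nat) : 'M[R[i]]_n :=
  \sum_(k < K) (k`!%:R)^-1 *: A ^+ k.

(** The value of [limn] is meaningful only for convergent sequences, so convergence is carried along
    with the limit through the induction below. *)
Definition mexp_cvg (R : realType) (n : nat) (A B : 'M[R[i]]_n) :=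
  forall r c, (fun K => mexp_psum A K r c : R[i]^o) @ \oo --> (B r c : R[i]^o).

Lemma mexp_cvgE (R : realType) (n : nat) (A B : 'M[R[i]]_n) :
  mexp_cvg A B -> mexp A = B.
Proof.
move=> AB; apply/matrixP => r c; rewrite mxE.
exact: (cvg_lim (@norm_hausdorff _ _) (AB r c)).
Qed.

Lemma cvg_complex (R : realType) (u v : nat -> R) (a b : R) :
  u @ \oo --> a -> v @ \oo --> b ->
  (fun n => u n +i* v n : R[i]^o) @ \oo --> (a +i* b : R[i]^o).
Proof.
move=> ua vb; apply/cvgrPdist_lt => -[e e'].
(* A positive element of [R[i]] is real, so its real part can be halved between the two
   coordinates. *)
rewrite ltcE /= => /andP[/eqP -> e_gt0].
have e2_gt0 : 0 < e / 2 by rewrite divr_gt0.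
move/cvgrPdist_lt: ua => /(_ _ e2_gt0) ua; move/cvgrPdist_lt: vb => /(_ _ e2_gt0) vb.
near=> n.
have -> : (a +i* b) - (u n +i* v n) = (a - u n)%:C + (0 +i* (b - v n)) by simpc.
apply: le_lt_trans (ler_normD _ _) _.
have -> : e +i* 0 = (e / 2)%:C + (e / 2)%:C by rewrite -rmorphD -splitr.
have normC x : `|x%:C| = `|x|%:C :> R[i] by rewrite normc_def /= expr0n addr0 sqrtr_sqr.
have normI x : `|0 +i* x| = `|x|%:C :> R[i] by rewrite normc_def /= expr0n add0r sqrtr_sqr.
by rewrite normC normI ltrD // ltcR; near: n.
Unshelve. all: by end_near.
Qed.

Lemma imag_exp_coeff (R : realType) (x : R) (k : nat) :
  (k`!%:R)^-1 * (0 +i* x) ^+ k = cos_coeff x k +i* sin_coeff x k.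
Proof.
have i2 : (0 +i* 1 : R[i]) ^+ 2 = -1 by rewrite expr2; simpc.
have -> : (0 +i* x) = (0 +i* 1) * x%:C by simpc.
rewrite exprMn -rmorphXn -(rmorph_nat (real_complex R)) -fmorphV mulrCA -rmorphM.
have -> : (0 +i* 1 : R[i]) ^+ k = (((~~ odd k)%:R * (-1) ^+ k./2)%:C + (0 +i* ((odd k)%:R * (-1) ^+ k.-1./2))).
  rewrite -{1}(odd_double_half k) -mul2n addnC exprD exprM i2.
  (* For odd [k] the halves of [k] and [k - 1] agree, which matches the exponent in [sin_coeff]. *)
  have -> : k.-1./2 = if odd k then k./2 else k.-1./2 by case: ifP => // k_odd; have := odd_double_half k; lia.
  have sgnC m : (-1) ^+ m = ((-1) ^+ m)%:C :> R[i] by rewrite rmorphXn rmorphN1.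
  by rewrite sgnC; case: (odd k); simpc.
by rewrite /cos_coeff /sin_coeff /=; simpc; congr (_ +i* _); rewrite ?exprnP; ring.
Qed.

Lemma cvg_expi (R : realType) (x : R) :
  (fun K => \sum_(k < K) (k`!%:R)^-1 * (0 +i* x) ^+ k : R[i]^o) @ \oo --> (expi x : R[i]^o).
Proof.
rewrite (_ : (fun K => _) = fun K => series (cos_coeff x) K +i* series (sin_coeff x) K).
  by apply: cvg_complex; [rewrite cos.unlock; exact: is_cvg_series_cos_coeff |
     rewrite sin.unlock; exact: is_cvg_series_sin_coeff].
apply/funext => K; rewrite /series /= !big_mkord.
elim: K => [|K IHK]; first by rewrite !big_ord0.
by rewrite !big_ord_recr /= IHK imag_exp_coeff.
Qed.

Lemma expi0 (R : realType) : expi (0 : R) = 1.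
Proof. by rewrite /expi cos0 sin0. Qed.

Lemma expiD (R : realType) (x y : R) : expi (x + y) = expi x * expi y.
Proof. by rewrite /expi cosD sinD; simpc; congr (_ +i* _); ring. Qed.

Lemma mxZAl (F : pzRingType) (n : nat) (c : F) (A B : 'M[F]_n) : c *: (A * B) = c *: A * B.
Proof. exact: scalemxAl. Qed.

Lemma mxZAr (F : comPzRingType) (n : nat) (c : F) (A B : 'M[F]_n) : c *: (A * B) = A * (c *: B).
Proof. exact: scalemxAr. Qed.

(** Since [e] commutes with [A], the ranges of [e] and [1 - e] are invariant; the operator acts as
    [A + c] on the first and as [A] on the second. *)
Lemma expr_addZ_idem (F : comPzRingType) (n : nat) (A e : 'M[F]_n) (c : F) (k : nat) :
  e * e = e -> GRing.comm A e ->
  (A + c *: e) ^+ k = A ^+ k * (1 - e) + (A + c%:M) ^+ k * e.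
Proof.
move=> ee Ae; elim: k => [|k IHk]; first by rewrite !expr0 !mul1r subrK.
have eAk : e * (A ^+ k * (1 - e)) = 0.
  by rewrite mulrA (commrX k (commr_sym Ae)) -mulrA mulrBr mulr1 ee subrr mulr0.
have eBk : e * ((A + c%:M) ^+ k * e) = (A + c%:M) ^+ k * e.
  rewrite mulrA (commrX k (_ : GRing.comm e (A + c%:M))) -?mulrA ?ee //.
  by apply: commrD; [exact: commr_sym | exact/comm_mx_scalar].
rewrite exprS IHk mulrDl -mxZAl (mulrDr e) eAk add0r eBk mulrDr.
rewrite !exprS mulrDl !mulrA -!addrA; congr (_ + _).
by rewrite -mul_scalar_mx mulmxE !mulrA -!mulrDl.
Qed.

Lemma mexp_cvg_addZ_idem (R : realType) (n : nat) (A e B D : 'M[R[i]]_n) (c : R[i]) :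
  e * e = e -> GRing.comm A e -> mexp_cvg A B -> mexp_cvg (A + c%:M) D ->
  mexp_cvg (A + c *: e) (B * (1 - e) + D * e).
Proof.
move=> ee Ae AB AD r j.
have -> : (fun K => mexp_psum (A + c *: e) K r j : R[i]^o) =
  fun K => \sum_l mexp_psum A K r l * (1 - e) l j +
           \sum_l mexp_psum (A + c%:M) K r l * e l j.
  apply/funext => K.
  have -> : mexp_psum (A + c *: e) K =
    mexp_psum A K *m (1 - e) + mexp_psum (A + c%:M) K *m e.
    rewrite /mexp_psum !mulmx_suml -big_split /=; apply: eq_bigr => k _.
    by rewrite expr_addZ_idem // scalerDr !scalemxAl.
  by rewrite mxE !mxE.
rewrite mxE -!mulmxE !mxE.
have sumcvg (X Y Z : 'M[R[i]]_n) : mexp_cvg X Y ->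
  (fun K => \sum_l mexp_psum X K r l * Z l j : R[i]^o) @ \oo -->
  (\sum_l Y r l * Z l j : R[i]^o).
  move=> XY; elim: (index_enum _) => [|l s IHs].
    by rewrite big_nil; under eq_fun do rewrite big_nil; exact: cvg_cst.
  rewrite big_cons; under eq_fun do rewrite big_cons.
  exact: (cvgD (cvgM (XY r l) (cvg_cst _)) IHs).
by apply: cvgD; exact: sumcvg.
Qed.

Lemma mexp_cvg_scalar (R : realType) (n : nat) (x : R) :
  mexp_cvg ((0 +i* x)%:M : 'M[R[i]]_n) (expi x)%:M.
Proof.
move=> r c.
have -> : (fun K => mexp_psum ((0 +i* x)%:M : 'M[R[i]]_n) K r c : R[i]^o) =
  fun K => (\sum_(k < K) (k`!%:R)^-1 * (0 +i* x) ^+ k) * (r == c)%:R.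
  apply/funext => K; rewrite /mexp_psum summxE mulr_suml; apply: eq_bigr => k _.
  by rewrite -rmorphXn /= !mxE mulr_natr mulrnAr.
by rewrite mxE -[expi x *+ _]mulr_natr; exact: (cvgM (@cvg_expi R x) (cvg_cst _)).
Qed.

(** The scalar term makes the induction close: peeling off [e i] requires the exponential of the
    remaining sum both as it is and shifted by [i * th i], and the shift is absorbed into [x]. *)
Lemma mexp_cvg_sum_idem (R : realType) (n : nat) (I : Type) (r : seq I)
    (th : I -> R) (e : I -> 'M[R[i]]_n) (x : R) :
  (forall i, e i * e i = e i) -> (forall i j, GRing.comm (e i) (e j)) ->
  mexp_cvg ((0 +i* x)%:M + \sum_(i <- r) (0 +i* th i) *: e i)
           ((expi x)%:M * \prod_(i <- r) (1 + (expi (th i) - 1) *: e i)).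
Proof.
move=> ee eC; elim: r x => [|i r IHr] x.
  by rewrite !big_nil addr0 mulr1; exact: mexp_cvg_scalar.
rewrite !big_cons.
set S := \sum_(j <- r) _; set Q := \prod_(j <- r) _.
have eS : GRing.comm (e i) S.
  apply: commr_sum => j _; rewrite /GRing.comm -mxZAl -mxZAr.
  by rewrite (eC i j).
have eQ : GRing.comm (e i) Q.
  apply: commr_prod => j _; apply: commrD; first exact: commr1.
  by rewrite /GRing.comm -mxZAl -mxZAr (eC i j).
rewrite addrCA addrA [_ *: _ + _]addrC -addrA [_ *: _ + _]addrC addrA.
have -> : (expi x)%:M * ((1 + (expi (th i) - 1) *: e i) * Q) =
  ((expi x)%:M * Q) * (1 - e i) + ((expi (x + th i))%:M * Q) * e i.
  rewrite expiD -!mulmxE !mul_scalar_mx -!scalemxAl -scalerA -scalerDr; congr (_ *: _).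
  rewrite !mulmxE mulrDl mul1r mulrBr mulr1 -mxZAl eQ.
  by rewrite scalerBl scale1r -addrA [- _ + _]addrC.
apply: mexp_cvg_addZ_idem => //.
  apply: commr_sym; apply: commrD => //; exact/comm_mx_scalar.
rewrite addrAC -rmorphD /=.
have -> : (0 +i* x) + (0 +i* th i) = 0 +i* (x + th i) by simpc.
exact: IHr.
Qed.

Lemma mexp_sum_idem (R : realType) (n : nat) (I : Type) (r : seq I)
    (th : I -> R) (e : I -> 'M[R[i]]_n) :
  (forall i, e i * e i = e i) -> (forall i j, GRing.comm (e i) (e j)) ->
  mexp (\sum_(i <- r) (0 +i* th i) *: e i) =
    \prod_(i <- r) (1 + (expi (th i) - 1) *: e i).
Proof.
move=> ee eC; apply: mexp_cvgE; have := @mexp_cvg_sum_idem _ _ _ r th e 0 ee eC.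
by rewrite expi0 -mulmxE mul1mx raddf0 add0r.
Qed.

(** * Antiperiodic Fourier phases *)

Lemma expiX (R : realType) (x : R) (n : nat) : expi x ^+ n = expi (x *+ n).
Proof.
elim: n => [|n IHn]; first by rewrite expr0 mulr0n expi0.
by rewrite exprS IHn mulrS expiD.
Qed.

Lemma conj_expi (R : realType) (x : R) : conjc (expi x) = expi (- x).
Proof. by rewrite /expi cosN sinN. Qed.

Lemma expi_pi (R : realType) : expi (pi : R) = -1.
Proof. by rewrite /expi cospi sinpi -(rmorphN1 (real_complex R)). Qed.

(** By the double-angle formula, [cos x = 1] would force [sin (x / 2) = 0], whereas [x / 2] lies
    strictly between 0 and [pi]. *)
Lemma expi_neq1 (R : realType) (x : R) : 0 < x < pi *+ 2 -> expi x != 1.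
Proof.
move=> /andP[x_gt0 x_lt]; apply/eqP => -[+ _].
have -> : x = (x / 2) *+ 2 by rewrite -mulr_natr mulfVK.
rewrite cos_mulr2n => cE.
have : 0 < sin (x / 2).
  by apply: sin_gt0_pi; rewrite divr_gt0 //= ltr_pdivrMr // mulr_natr.
move=> s_gt0; have := cos2Dsin2 (x / 2); have : 0 < sin (x / 2) ^+ 2 by rewrite exprn_gt0.
lra.
Qed.

Lemma expi_prim_root (R : realType) (N : nat) :
  (0 < N)%N -> N.-primitive_root (expi (pi *+ 2 / N%:R : R)).
Proof.
move=> N_gt0; have N0 : N%:R != 0 :> R by rewrite pnatr_eq0 -lt0n.
apply/andP; split => //; apply/forallP => k; rewrite unity_rootE expiX.
have [->|neq_kN] /= := eqVneq k.+1 N.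
  rewrite -[_ *+ N]mulr_natr mulfVK // mulr2n expiD expi_pi; apply/eqP/eqP; ring.
rewrite (negbTE (expi_neq1 _)) //.
have pi2_gt0 : 0 < pi *+ 2 :> R by rewrite pmulrn_lgt0 // pi_gt0.
have NR_gt0 : 0 < N%:R :> R by rewrite ltr0n.
rewrite -[_ *+ k.+1]mulr_natr mulr_gt0 ?divr_gt0 ?ltr0n  //=.
rewrite mulrAC ltr_pdivrMr // ltr_pM2l  // ltr_nat.
by rewrite ltn_neqAle neq_kN ltn_ord.
Qed.

Lemma sum_geom_unity (F : fieldType) (N : nat) (x : F) :
  x ^+ N = 1 -> \sum_(t < N) x ^+ t = if x == 1 then N%:R else 0.
Proof.
move=> xN; case: eqVneq => [->|x_neq1].
  by under eq_bigr do rewrite expr1n; rewrite sumr_const card_ord.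
apply/eqP; move: (subrX1 x N); rewrite xN subrr => /esym/eqP.
by rewrite mulf_eq0 subr_eq0 (negbTE x_neq1).
Qed.

(** This is the factorisation of [X^N - 1] over the powers of [w], evaluated at [x^-1] and
    multiplied by [x^N]. *)
Lemma prod_1sub_coset_unity (F : fieldType) (N : nat) (x w : F) :
  N.-primitive_root w -> x != 0 -> \prod_(n < N) (1 - x * w ^+ n) = 1 - x ^+ N.
Proof.
move=> w_prim x_neq0.
have -> : \prod_(n < N) (1 - x * w ^+ n) = \prod_(n < N) (x * (x^-1 - w ^+ n)).
  by apply: eq_bigr => n _; rewrite mulrBr mulfV.
rewrite big_split /= prodr_const card_ord.
have := congr1 (fun p => p.[x^-1]) (factor_Xn_sub_1 w_prim).
rewrite /= horner_prod big_mkord => pE.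
under eq_bigr do rewrite -[_ - _]hornerXsubC.
by rewrite pE; rewrite !hornerE mulrBr mulr1 -exprMn mulfV ?expr1n.
Qed.

(* [e^{i omega_n eps}]: the value of [eps] cancels. *)
Definition phase (R : realType) (N n : nat) : R[i] :=
  expi (((2 * n%:R + 1) * pi) / N%:R).

Lemma omega_eps (R : realType) (N n : nat) (eps : R) :
  0 < eps -> omega N eps n * eps = ((2 * n%:R + 1) * pi) / N%:R.
Proof.
move=> eps_gt0; rewrite /omega invfM [_^-1 * _]mulrC mulrA mulfVK //.
by rewrite gt_eqF.
Qed.

(** The phases form a coset of the [N]-th roots of unity. *)
Lemma phaseE (R : realType) (N n : nat) :
  phase R N n = phase R N 0 * expi (pi *+ 2 / N%:R : R) ^+ n.
Proof.
rewrite /phase expiX -expiD; congr expi.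
by rewrite -mulr_natr -[pi *+ 2]mulr_natr; ring.
Qed.

Lemma phaseXN (R : realType) (N n : nat) : (0 < N)%N -> phase R N n ^+ N = -1.
Proof.
move=> N_gt0; rewrite phaseE exprMn -exprM mulnC exprM.
rewrite (prim_expr_order (expi_prim_root R N_gt0)) expr1n mulr1 /phase expiX -[_ *+ N]mulr_natr mulfVK ?pnatr_eq0 -?lt0n //.
by rewrite mulr0 add0r mul1r expi_pi.
Qed.

Lemma phase_conj (R : realType) (N n : nat) : phase R N n * conjc (phase R N n) = 1.
Proof. by rewrite /phase conj_expi -expiD subrr expi0. Qed.

Lemma phase_neq0 (R : realType) (N n : nat) : phase R N n != 0.
Proof.
by apply/eqP => z0; have := phase_conj R N n; rewrite z0 mul0r => /eqP; rewrite eq_sym oner_eq0.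
Qed.

Lemma phase_conjV (R : realType) (N n : nat) : conjc (phase R N n) = (phase R N n)^-1.
Proof. by apply: (mulfI (phase_neq0 R N n)); rewrite phase_conj mulfV // phase_neq0. Qed.

Lemma phase_neq1 (R : realType) (N n : nat) : (0 < N)%N -> phase R N n != 1.
Proof.
move=> N_gt0; apply/eqP => z1; have := phaseXN R n N_gt0.
by rewrite z1 expr1n => /eqP; rewrite -addr_eq0 -mulr2n pnatr_eq0.
Qed.

Lemma phase_inj (R : realType) (N : nat) (n m : 'I_N) :
  (phase R N n == phase R N m) = (n == m).
Proof.
have N_gt0 : (0 < N)%N by apply: leq_ltn_trans (ltn_ord n).
rewrite phaseE (phaseE R N m) (inj_eq (mulfI (phase_neq0 R N 0))).
by rewrite (eq_prim_root_expr (expi_prim_root R N_gt0)) !modn_small.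
Qed.

Lemma prod_1sub_phase (R : realType) (N : nat) :
  (0 < N)%N -> \prod_(n < N) (1 - phase R N n) = 2.
Proof.
move=> N_gt0; under eq_bigr do rewrite phaseE.
rewrite prod_1sub_coset_unity ?expi_prim_root ?phase_neq0 // phaseXN //; ring.
Qed.

Definition fourier (R : realType) (N : nat) (n t : nat) : R[i] :=
  ((Num.sqrt (N%:R : R))^-1)%:C * phase R N n ^+ t.

Lemma conj_fourier (R : realType) (N n t : nat) :
  conjc (fourier R N n t) = ((Num.sqrt (N%:R : R))^-1)%:C * phase R N n ^- t.
Proof.
have cM (x y : R[i]) : conjc (x * y) = conjc x * conjc y by exact: (rmorphM (@conjc R)).
have cX (x : R[i]) k : conjc (x ^+ k) = conjc x ^+ k by exact: (rmorphXn (@conjc R)).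
by rewrite /fourier cM cX phase_conjV exprVn /= oppr0.
Qed.

(** The ratio of two phases is an [N]-th root of unity because the two signs cancel, so the
    geometric sum vanishes unless the phases coincide. *)
Lemma fourier_row (R : realType) (N : nat) (n m : 'I_N) :
  \sum_(t < N) fourier R N n t * conjc (fourier R N m t) = (n == m)%:R.
Proof.
have N_gt0 : (0 < N)%N by apply: leq_ltn_trans (ltn_ord n).
pose x := phase R N n / phase R N m.
rewrite (eq_bigr (fun t : 'I_N => (N%:R)^-1 * x ^+ t)) => [|t _]; last first.
  rewrite conj_fourier /fourier mulrACA exprMn exprVn -rmorphM; congr (_ * _).
  by rewrite -invfM -expr2 sqr_sqrtr ?ler0n // fmorphV rmorph_nat.
rewrite -mulr_sumr sum_geom_unity; last first.
  by rewrite exprMn exprVn !phaseXN // mulfV // oppr_eq0 oner_eq0.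
rewrite -(inj_eq (mulIf (phase_neq0 R N m))) mulfVK ?phase_neq0 // mul1r phase_inj.
by case: (n == m); rewrite ?mulr0 // mulVf // pnatr_eq0 -lt0n.
Qed.

(** A one-sided inverse of a square matrix is two-sided, so row orthogonality gives column
    orthogonality. *)
Lemma fourier_col (R : realType) (N : nat) (s t : 'I_N) :
  \sum_(n < N) conjc (fourier R N n s) * fourier R N n t = (s == t)%:R.
Proof.
pose W : 'M[R[i]]_N := \matrix_(n, t) fourier R N n t.
pose W' : 'M[R[i]]_N := \matrix_(t, n) conjc (fourier R N n t).
have WW' : W *m W' = 1%:M.
  apply/matrixP => n m; rewrite !mxE -[RHS]fourier_row.
  by apply: eq_bigr => k _; rewrite !mxE.
have := congr1 (fun A : 'M[R[i]]_N => A s t) (mulmx1C WW'); rewrite !mxE => <-.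
by apply: eq_bigr => k _; rewrite !mxE.
Qed.

Lemma conj_fourierS (R : realType) (N n t : nat) :
  phase R N n * conjc (fourier R N n t.+1) = conjc (fourier R N n t).
Proof.
rewrite !conj_fourier mulrCA; congr (_ * _).
by rewrite exprS invfM mulrA mulfV ?phase_neq0 ?mul1r.
Qed.

(** Antiperiodicity: time 0 is identified with time [N] up to the sign [z^N = -1], after which the
    ordinary shift applies. *)
Lemma conj_fourier0 (R : realType) (N n : nat) : (0 < N)%N ->
  phase R N n * conjc (fourier R N n 0) = - conjc (fourier R N n N.-1).
Proof.
move=> N_gt0; have -> : conjc (fourier R N n 0) = - conjc (fourier R N n N).
  by rewrite !conj_fourier phaseXN // expr0 invrN1 invr1 mulrN1 opprK mulr1.
by rewrite mulrN -[in LHS](prednK N_gt0) conj_fourierS prednK.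
Qed.

(** * Gaussian operators in a CAR algebra *)

Definition anticomm (F : pzRingType) (d : nat) (A B : 'M[F]_d) : 'M[F]_d := A * B + B * A.

Lemma anticomm_sum (F : comPzRingType) (d : nat) (I J : finType)
    (x : I -> F) (y : J -> F) (A : I -> 'M[F]_d) (B : J -> 'M[F]_d) :
  anticomm (\sum_i x i *: A i) (\sum_j y j *: B j) =
    \sum_i \sum_j (x i * y j) *: anticomm (A i) (B j).
Proof.
rewrite /anticomm !mulr_suml.
under eq_bigr do rewrite mulr_sumr.
under [X in _ + X]eq_bigr do rewrite mulr_sumr.
rewrite [X in _ + X]exchange_big -big_split /=; apply: eq_bigr => i _.
rewrite -big_split; apply: eq_bigr => j _ /=.
by rewrite -!mxZAl -!mxZAr !scalerA scalerDr [y j * x i]mulrC.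
Qed.

(* Canonical anticommutation relations: [b] annihilates and [c] creates. *)
Definition is_car (F : pzRingType) (d : nat) (I : finType) (b c : I -> 'M[F]_d) :=
  [/\ forall i j, anticomm (b i) (b j) = 0,
      forall i j, anticomm (c i) (c j) = 0 &
      forall i j, anticomm (b i) (c j) = ((i == j)%:R)%:M].

Lemma mxtrace_mulCA (F : comPzRingType) (d : nat) (A B D : 'M[F]_d) :
  \tr (A * (B * D)) = \tr (D * A * B).
Proof. by rewrite mulrA -mulmxE mxtrace_mulC mulmxE mulrA. Qed.

Section CAR.
Variables (F : numFieldType) (d : nat) (I : finType) (b c : I -> 'M[F]_d).
Hypothesis carbc : is_car b c.

Let bb i j : b i * b j = - (b j * b i).
Proof. by case: carbc => bb _ _; apply/eqP; rewrite -addr_eq0; apply/eqP/bb. Qed.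

Let cc i j : c i * c j = - (c j * c i).
Proof. by case: carbc => _ cc _; apply/eqP; rewrite -addr_eq0; apply/eqP/cc. Qed.

Let bc i j : b i * c j = ((i == j)%:R)%:M - c j * b i.
Proof. by case: carbc => _ _ <-; rewrite /anticomm addrK. Qed.

Let eq_opp0 (A : 'M[F]_d) : A = - A -> A = 0.
Proof.
move=> /eqP; rewrite -addr_eq0 -mulr2n -scaler_nat => /eqP A2.
by apply/eqP; have /eqP := A2; rewrite scaler_eq0 pnatr_eq0.
Qed.

Let sqb i : b i * b i = 0. Proof. exact/eq_opp0/bb. Qed.
Let sqc i : c i * c i = 0. Proof. exact/eq_opp0/cc. Qed.

Definition occ i := c i * b i.

Lemma occ_idem i : occ i * occ i = occ i.
Proof.
rewrite /occ -mulrA (mulrA (b i)) bc eqxx mulrBl -mulrA sqb mulr0 subr0.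
by rewrite -mulmxE mul1mx.
Qed.

(** For the same mode, [b n = b] and [n b = 0]; for distinct modes, [b i] passes two operators and
    the two signs cancel. *)
Lemma mul_ann_occ i j (y : F) :
  b i * (1 + y *: occ j) = (if i == j then 1 + y else 1) *: ((1 + y *: occ j) * b i).
Proof.
rewrite mulrDr mulrDl mul1r mulr1 -mxZAr -mxZAl /occ.
case: eqVneq => [<-|neq_ij].
  rewrite mulrA bc eqxx mulrBl -!mulrA sqb !mulr0 subr0 scaler0 addr0.
  by rewrite -mulmxE mul1mx scalerDl scale1r.
by rewrite scale1r mulrA bc (negbTE neq_ij) raddf0 sub0r mulNr -mulrA bb mulrN opprK mulrA.
Qed.

Lemma mul_occ_cre i j (y : F) :
  (1 + y *: occ j) * c i = (if i == j then 1 + y else 1) *: (c i * (1 + y *: occ j)).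
Proof.
rewrite mulrDr mulrDl mul1r mulr1 -mxZAr -mxZAl /occ.
case: eqVneq => [<-|neq_ij].
  rewrite -mulrA bc eqxx mulrBr !mulrA sqc !mul0r subr0 scaler0 addr0.
  by rewrite -mulmxE mulmx1 scalerDl scale1r.
rewrite scale1r -mulrA bc eq_sym (negbTE neq_ij) raddf0 sub0r mulrN mulrA cc.
by rewrite mulNr opprK mulrA.
Qed.

Lemma occ_comm i j : GRing.comm (occ i) (occ j).
Proof.
have [->|neq_ij] := eqVneq i j; first exact: commr_refl.
(* For distinct modes the scalar is 1, so with [y = 1] both [b i] and [c i] are seen to commute with
   [occ j]. *)
have := mul_ann_occ i j 1; have := mul_occ_cre i j 1.
rewrite (negbTE neq_ij) !scale1r mulrDl mulrDr mul1r mulr1 => /addrI cE.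
rewrite mulrDl mulrDr mul1r mulr1 => /addrI bE.
by rewrite /GRing.comm {1}/occ -mulrA bE mulrA -cE -mulrA.
Qed.

(** A mode listed once contributes 1 when empty and [1 + y j] when occupied; this is the form taken
    by exponentials of quadratic number-type operators. *)
Definition gaussian (y : I -> F) (r : seq I) := \prod_(j <- r) (1 + y j *: occ j).

Lemma gaussian_cons (y : I -> F) i (r : seq I) :
  gaussian y (i :: r) = (1 + y i *: occ i) * gaussian y r.
Proof. exact: big_cons. Qed.

Lemma gaussian_comm_occ (y : I -> F) (r : seq I) i (x : F) :
  GRing.comm (1 + x *: occ i) (gaussian y r).
Proof.
apply: commr_prod => j _; apply: commrD; first exact: commr1.
apply: commr_sym; apply: commrD; first exact: commr1.
by rewrite /GRing.comm -!mxZAl -!mxZAr occ_comm scalerA mulrC -scalerA.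
Qed.

(** The factors commute and can be paired mode by mode; idempotence of [occ] then multiplies the
    occupied values [1 + x] and [1 + y]. *)
Lemma gaussian_mul (x y : I -> F) (r : seq I) :
  gaussian x r * gaussian y r = gaussian (fun i => x i + y i + x i * y i) r.
Proof.
elim: r => [|i r IHr]; first by rewrite /gaussian !big_nil mulr1.
rewrite !gaussian_cons -IHr -mulrA (mulrA (gaussian x r)).
rewrite -(gaussian_comm_occ x r i (y i)) !mulrA; congr (_ * _ * _).
rewrite mulrDr !mulrDl !mul1r !mulr1 -mxZAl -mxZAr occ_idem scalerA.
by rewrite !scalerDl -!addrA.
Qed.

Lemma mul_ann_gaussian_seq (y : I -> F) (r : seq I) i :
  b i * gaussian y r =
    (\prod_(j <- r) if i == j then 1 + y j else 1) *: (gaussian y r * b i).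
Proof.
elim: r => [|j r IHr].
  by rewrite /gaussian !big_nil mulr1 mul1r scale1r.
rewrite gaussian_cons big_cons mulrA mul_ann_occ -mxZAl.
by rewrite -[_ * b i * _]mulrA IHr -mxZAr scalerA mulrA.
Qed.

Lemma mul_gaussian_cre_seq (y : I -> F) (r : seq I) i :
  gaussian y r * c i =
    (\prod_(j <- r) if i == j then 1 + y j else 1) *: (c i * gaussian y r).
Proof.
elim: r => [|j r IHr].
  by rewrite /gaussian !big_nil mulr1 mul1r scale1r.
rewrite gaussian_cons big_cons -mulrA IHr -mxZAr (mulrA _ (c i)) mul_occ_cre.
by rewrite -mxZAl scalerA mulrC (mulrA (c i)).
Qed.

Let prod_if_eq (y : I -> F) i : \prod_j (if i == j then 1 + y j else 1) = 1 + y i.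
Proof. by rewrite -big_mkcond (big_pred1 i) // => j; rewrite eq_sym. Qed.

Lemma mul_ann_gaussian (y : I -> F) i :
  b i * gaussian y (index_enum I) = (1 + y i) *: (gaussian y (index_enum I) * b i).
Proof. by rewrite mul_ann_gaussian_seq prod_if_eq. Qed.

Lemma mul_gaussian_cre (y : I -> F) i :
  gaussian y (index_enum I) * c i = (1 + y i) *: (c i * gaussian y (index_enum I)).
Proof. by rewrite mul_gaussian_cre_seq prod_if_eq. Qed.

(* Cyclicity moves [b i] around [A], so that [\tr (A c b) = \tr (A b c) = \tr A - \tr (A c b)]. *)
Lemma mxtrace_mul_occ (A : 'M[F]_d) i (y : F) :
  b i * A = A * b i -> \tr (A * (1 + y *: occ i)) = (1 + y / 2) * \tr A.
Proof.
move=> bA; have trE : \tr (A * occ i) = \tr A - \tr (A * occ i).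
  rewrite {1}/occ [LHS]mxtrace_mulCA bA -mulrA bc eqxx mulrBr raddfB /=.
  by rewrite (mulmx1 A : A * 1%:M = A).
have tr2 : \tr (A * occ i) = \tr A / 2.
  apply: (canRL (mulfK _)); first by rewrite pnatr_eq0.
  by rewrite mulr_natr mulr2n {1}trE subrK.
rewrite mulrDr mulr1 raddfD /= -mxZAr mxtraceZ tr2 mulrDl mul1r.
by rewrite mulrA mulrAC.
Qed.

(** Uniqueness makes [b i] commute with the factors of all other modes, so each mode splits off the
    average [1 + y / 2] of its empty and occupied values. *)
Lemma mxtrace_gaussian (y : I -> F) (r : seq I) :
  uniq r -> \tr (gaussian y r) = d%:R * \prod_(i <- r) (1 + y i / 2).
Proof.
elim: r => [|i r IHr] /=; first by rewrite /gaussian !big_nil mxtrace1 mulr1.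
case/andP=> i_notin uniq_r.
have bG : b i * gaussian y r = gaussian y r * b i.
  rewrite mul_ann_gaussian_seq big_seq big1 ?scale1r // => j j_in.
  by rewrite ifN //; apply: contraNneq i_notin => ->.
rewrite gaussian_cons big_cons -mulmxE mxtrace_mulC mulmxE.
rewrite (mxtrace_mul_occ _ bG) (IHr uniq_r).
exact: mulrCA.
Qed.

End CAR.

(** * The twisted trace *)

Lemma car_fann (R : realType) (M : nat) (I : finType) (f : I -> nat) :
  injective f -> (forall i, (f i < M)%N) ->
  is_car (fun i => fann R M (f i)) (fun i => adj (fann R M (f i))).
Proof.
move=> f_inj f_lt; split => i j; rewrite ?adj_fannE ?fannE /anticomm.
- by rewrite (ladder_anticomm R true true (f_lt i) (f_lt j)) andbF raddf0.
- by rewrite (ladder_anticomm R false false (f_lt i) (f_lt j)) andbF raddf0.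
- by rewrite (ladder_anticomm R true false (f_lt i) (f_lt j)) andbT (inj_eq f_inj).
Qed.

Lemma car_a_h (R : realType) (L : nat) :
  is_car (fun i : 'I_L => a_h R i) (fun i => adj (a_h R i)).
Proof. exact: (car_fann R (@ord_inj L) (@ltn_ord L)). Qed.

Lemma car_a_H (R : realType) (L N : nat) :
  is_car (fun p : 'I_N * 'I_L => a_H R p.1 p.2) (fun p => adj (a_H R p.1 p.2)).
Proof.
apply: (car_fann R (f := fun p : 'I_N * 'I_L => p.1 * L + p.2)%N) => [[t i] [s j]|[t i]] /=.
  (* Euclidean division by [L] recovers the time and the mode from [t * L + i]. *)
  move=> E; have L_gt0 : (0 < L)%N by apply: leq_ltn_trans (ltn_ord i).
  have ts : t = s :> nat.
    by have := congr1 (divn^~ L) E; rewrite /= !divnMDl // !divn_small // !addn0.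
  have ij : i = j :> nat by move: E; rewrite ts => /addnI.
  by rewrite (ord_inj ts) (ord_inj ij).
rewrite mulnC; apply: leq_trans (_ : L * t.+1 <= _)%N; last by rewrite leq_mul2l ltn_ord orbT.
by rewrite mulnS addnC ltn_add2r.
Qed.

Lemma adj_sum (R : realType) (d : nat) (I : finType) (x : I -> R[i]) (A : I -> 'M[R[i]]_d) :
  adj (\sum_i x i *: A i) = \sum_i conjc (x i) *: adj (A i).
Proof.
apply/matrixP => r c; rewrite !mxE !summxE.
rewrite (raddf_sum (@conjc R)); apply: eq_bigr => k _; rewrite !mxE.
exact: (rmorphM (@conjc R)).
Qed.

(** * Fourier modes and their inversion *)

Section Fourier.
Variables (R : realType) (d L N : nat).
Variables (a c : 'I_N * 'I_L -> 'M[R[i]]_d).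

Definition fourier_ann (p : 'I_N * 'I_L) := \sum_(t < N) fourier R N p.1 t *: a (t, p.2).
Definition fourier_cre (p : 'I_N * 'I_L) :=
  \sum_(t < N) conjc (fourier R N p.1 t) *: c (t, p.2).

Lemma car_fourier : is_car a c -> is_car fourier_ann fourier_cre.
Proof.
case=> aa cc ac; split => p q; rewrite /fourier_ann /fourier_cre anticomm_sum.
- by rewrite big1 // => s _; rewrite big1 // => t _; rewrite aa scaler0.
- by rewrite big1 // => s _; rewrite big1 // => t _; rewrite cc scaler0.
rewrite (eq_bigr (fun s : 'I_N => (fourier R N p.1 s * conjc (fourier R N q.1 s)) *:
    ((p.2 == q.2)%:R)%:M)) => [|s _].
  rewrite -scaler_suml fourier_row scale_scalar_mx -natrM mulnb.
  by case: p q => [n i] [m j]; rewrite xpair_eqE.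
rewrite (bigD1 s) //= big1 ?addr0 => [|t neq_ts]; rewrite ac xpair_eqE ?eqxx //=.
by rewrite eq_sym (negbTE neq_ts) raddf0 scaler0.
Qed.

Lemma fourier_annK t j : a (t, j) = \sum_(n < N) conjc (fourier R N n t) *: fourier_ann (n, j).
Proof.
under eq_bigr do rewrite /fourier_ann scaler_sumr.
rewrite exchange_big (bigD1 t) //= [X in _ + X]big1 ?addr0 => [|s neq_st].
  under eq_bigr do rewrite scalerA.
  by rewrite -scaler_suml fourier_col eqxx scale1r.
under eq_bigr do rewrite scalerA.
by rewrite -scaler_suml fourier_col eq_sym (negbTE neq_st) scale0r.
Qed.

Lemma fourier_creK t j : c (t, j) = \sum_(n < N) fourier R N n t *: fourier_cre (n, j).
Proof.
under eq_bigr do rewrite /fourier_cre scaler_sumr.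
rewrite exchange_big (bigD1 t) //= [X in _ + X]big1 ?addr0 => [|s neq_st].
  under eq_bigr do rewrite scalerA mulrC.
  by rewrite -scaler_suml fourier_col eqxx scale1r.
under eq_bigr do rewrite scalerA mulrC.
by rewrite -scaler_suml fourier_col (negbTE neq_st) scale0r.
Qed.

(** The total number operator is invariant under a unitary change of modes; hence parity is a
    Gaussian in the Fourier modes too. *)
Lemma sum_occ_fourier : \sum_p occ a c p = \sum_p occ fourier_ann fourier_cre p.
Proof.
have pairE (F : 'I_N * 'I_L -> 'M[R[i]]_d) : \sum_p F p = \sum_j \sum_n F (n, j).
  by rewrite exchange_big pair_bigA; apply: eq_bigr => -[].
rewrite !pairE.
apply: eq_bigr => j _; rewrite /occ.
under eq_bigr do rewrite fourier_creK mulr_suml.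
rewrite exchange_big; apply: eq_bigr => n _ /=.
rewrite /fourier_ann mulr_sumr; apply: eq_bigr => t _.
by rewrite -mxZAl -mxZAr.
Qed.

End Fourier.

Lemma ahatE (R : realType) (L N : nat) (eps : R) (n : 'I_N) (j : 'I_L) :
  0 < eps -> ahat N eps n j = fourier_ann (fun p => a_H R p.1 p.2) (n, j).
Proof.
move=> eps_gt0; rewrite /ahat scaler_sumr; apply: eq_bigr => t _.
by rewrite scalerA /fourier omega_eps // mulr_natr -expiX.
Qed.

Lemma adj_ahatE (R : realType) (L N : nat) (eps : R) (n : 'I_N) (j : 'I_L) :
  0 < eps -> adj (ahat N eps n j) = fourier_cre (fun p => adj (a_H R p.1 p.2)) (n, j).
Proof. by move=> eps_gt0; rewrite ahatE // /fourier_ann adj_sum. Qed.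

(** * Twisted trace, time shift and two-point functions *)

Section TimeTranslation.
Variables (R : realType) (L N : nat).
Local Notation I := ('I_N * 'I_L)%type.
Let a (p : I) := a_H R p.1 p.2.
Let c (p : I) := adj (a p).
Let b := fourier_ann a.
Let bd := fourier_cre c.
Let car_a : is_car a c := car_a_H R L N.
Let car_b : is_car b bd := car_fourier car_a.

(* In the Fourier modes [P e^{i eps Pcal}] is [prod (1 - 2 n) (1 + (z - 1) n) = prod (1 - (1 + z) n)]. *)
Definition twist : 'M[R[i]]_(2 ^ (L * N)) :=
  gaussian b bd (fun p => - 1 - phase R N p.1) (index_enum I).

Lemma parityE : parity R L N = gaussian b bd (fun=> - 2) (index_enum I).
Proof.
rewrite /parity pair_bigA /=.
have -> : \sum_(p : I) adj (a_H R p.1 p.2) *m a_H R p.1 p.2 = \sum_p occ b bd p.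
  by rewrite -(sum_occ_fourier a c).
rewrite scaler_sumr (mexp_sum_idem _ (fun=> pi) (occ_idem car_b) (occ_comm car_b)).
by apply: eq_bigr => p _; rewrite expi_pi -opprD -natr1 addrC.
Qed.

Lemma mexp_PcalE (eps : R) : 0 < eps ->
  mexp ((0 +i* eps) *: Pcal L N eps) =
    gaussian b bd (fun p => phase R N p.1 - 1) (index_enum I).
Proof.
move=> eps_gt0; rewrite /Pcal pair_bigA scaler_sumr /=.
rewrite (eq_bigr (fun p : I => (0 +i* (omega N eps p.1 * eps)) *: occ b bd p)) => [|[n j] _].
  rewrite (mexp_sum_idem _ (fun p : I => omega N eps p.1 * eps) (occ_idem car_b) (occ_comm car_b)).
  by apply: eq_bigr => p _; rewrite omega_eps.
rewrite scalerA /occ /= adj_ahatE // ahatE //; congr (_ *: _).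
by simpc; rewrite mulrC.
Qed.

Lemma twistE (eps : R) : 0 < eps ->
  parity R L N *m mexp ((0 +i* eps) *: Pcal L N eps) = twist.
Proof.
move=> eps_gt0; rewrite parityE mexp_PcalE // mulmxE (gaussian_mul car_b).
(* The coefficients combine as [-2 + (z - 1) - 2 (z - 1) = -1 - z]. *)
by apply: eq_bigr => p _ /=; congr (_ + _ *: _); ring.
Qed.

(** Each mode averages 1 and [-z] to [(1 - z) / 2]. The product over frequencies is [2 / 2^N]; its
    [L]-th power times the dimension [2^(L N)] leaves [2^L]. *)
Lemma mxtrace_twist : (0 < N)%N -> \tr twist = (2 ^ L)%:R.
Proof.
move=> N_gt0; rewrite /twist (mxtrace_gaussian car_b) ?index_enum_uniq //.
rewrite -(pair_bigA _ (fun (n : 'I_N) (j : 'I_L) => 1 + (- 1 - phase R N n) / 2)) /=.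
rewrite (eq_bigr (fun n : 'I_N => ((1 - phase R N n) / 2) ^+ L)) => [|n _].
  rewrite prodrXl big_split /= prod_1sub_phase // prodr_const card_ord exprVn.
  rewrite !natrX mulnC exprM -exprMn mulrCA mulfV ?mulr1 //.
by rewrite prodr_const card_ord; congr (_ ^+ _); field.
Qed.

Lemma ann_twist p : b p * twist = - phase R N p.1 *: (twist * b p).
Proof. by rewrite (mul_ann_gaussian car_b) addrA subrr add0r. Qed.

Lemma twist_cre p : twist * bd p = - phase R N p.1 *: (bd p * twist).
Proof. by rewrite (mul_gaussian_cre car_b) addrA subrr add0r. Qed.

(** Passing the twist multiplies Fourier mode [n] by [-z_n], and the factor [z_n] lowers the time in
    the inverse transform by one step. *)
Lemma a_twistS (s t : 'I_N) j : t = s.+1 :> nat ->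
  a (t, j) * twist = - (twist * a (s, j)).
Proof.
move=> ts; rewrite !(fourier_annK a) mulr_suml mulr_sumr -sumrN; apply: eq_bigr => n _.
rewrite -mxZAl ann_twist -mxZAr scalerA -scaleNr; congr (_ *: _).
by rewrite mulrN mulrC ts conj_fourierS.
Qed.

Lemma a_twist0 (s t : 'I_N) j : t = 0%N :> nat -> s = N.-1 :> nat ->
  a (t, j) * twist = twist * a (s, j).
Proof.
move=> t0 sN; have N_gt0 : (0 < N)%N by apply: leq_ltn_trans (ltn_ord t).
rewrite !(fourier_annK a) mulr_suml mulr_sumr; apply: eq_bigr => n _.
rewrite -mxZAl ann_twist -mxZAr scalerA; congr (_ *: _).
by rewrite mulrN mulrC t0 sN conj_fourier0 // opprK.
Qed.

(** Exchanging the two annihilators and cycling one of them through the twist reproduces the trace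
    multiplied by a phase different from 1. *)
Lemma mxtrace_twist_ann2 p q : (0 < N)%N -> \tr (twist * b p * b q) = 0.
Proof.
move=> N_gt0; have [bb _ _] := car_b.
have bpq : b p * b q = - (b q * b p) by apply/eqP; rewrite -addr_eq0; apply/eqP/bb.
have trE : \tr (twist * b p * b q) = phase R N p.1 * \tr (twist * b p * b q).
  rewrite -{1}mulrA bpq mulrN raddfN /= mxtrace_mulCA ann_twist -mxZAl mxtraceZ.
  by rewrite mulNr opprK.
move/eqP: trE; rewrite -{1}[\tr _]mul1r -subr_eq0 -mulrBl mulf_eq0 subr_eq0 eq_sym.
by rewrite (negbTE (phase_neq1 R p.1 N_gt0)) => /eqP.
Qed.

Lemma mxtrace_twist_cre2 p q : (0 < N)%N -> \tr (twist * bd p * bd q) = 0.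
Proof.
move=> N_gt0; have [_ bb _] := car_b.
have bpq : bd q * bd p = - (bd p * bd q) by apply/eqP; rewrite -addr_eq0; apply/eqP/bb.
have trE : \tr (twist * bd p * bd q) = phase R N p.1 * \tr (twist * bd p * bd q).
  rewrite {1}twist_cre -mxZAl mxtraceZ -mulrA -mxtrace_mulCA bpq.
  by rewrite mulrN raddfN /= mulrNN mulrA.
move/eqP: trE; rewrite -{1}[\tr _]mul1r -subr_eq0 -mulrBl mulf_eq0 subr_eq0 eq_sym.
by rewrite (negbTE (phase_neq1 R p.1 N_gt0)) => /eqP.
Qed.

Let mxtrace_twist_sum2 (x y : 'I_N -> R[i]) (A B : 'I_N -> 'M[R[i]]_(2 ^ (L * N))) :
  (forall n m, \tr (twist * A n * B m) = 0) ->
  \tr (twist * (\sum_n x n *: A n) * (\sum_n y n *: B n)) = 0.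
Proof.
move=> AB; rewrite (mulr_sumr _ _ _ twist) mulr_suml raddf_sum big1 // => n _.
rewrite mulr_sumr raddf_sum big1 // => m _ /=.
by rewrite -!mxZAr -mxZAl !mxtraceZ AB !mulr0.
Qed.

Lemma mxtrace_twist_a2 p q : (0 < N)%N -> \tr (twist * a p * a q) = 0.
Proof.
case: p q => [t i] [s j] N_gt0; rewrite !(fourier_annK a).
by apply: mxtrace_twist_sum2 => n m; exact: mxtrace_twist_ann2.
Qed.

Lemma mxtrace_twist_c2 p q : (0 < N)%N -> \tr (twist * c p * c q) = 0.
Proof.
case: p q => [t i] [s j] N_gt0; rewrite !(fourier_creK c).
by apply: mxtrace_twist_sum2 => n m; exact: mxtrace_twist_cre2.
Qed.

(* Anticommuting [a] past [c] and cycling it through [twist] lowers its time by one. *)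
Let mxtrace_twist_ac t i q :
  \tr (twist * a (t, i) * c q) =
    (((t, i) == q)%:R) * \tr twist - \tr (a (t, i) * twist * c q).
Proof.
have [_ _ ac] := car_a.
have -> : twist * a (t, i) * c q = ((t, i) == q)%:R *: twist - twist * (c q * a (t, i)).
  rewrite -mulrA -(addrK (c q * a (t, i)) (a (t, i) * c q)) [_ + c q * _]ac mulrBr.
  by congr (_ - _); exact: mul_mx_scalar.
by rewrite raddfB /= mxtraceZ mxtrace_mulCA.
Qed.

Let D (i j : 'I_L) := ((i == j)%:R : R[i]) * \tr twist.

Let mxtrace_twist_acS (s t u : 'I_N) i j : t = s.+1 :> nat ->
  \tr (twist * a (t, i) * c (u, j)) =
    (t == u)%:R * D i j + \tr (twist * a (s, i) * c (u, j)).
Proof.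
move=> ts; rewrite mxtrace_twist_ac (a_twistS _ ts) mulNr raddfN opprK /=.
by rewrite xpair_eqE -mulnb natrM mulrA.
Qed.

Let mxtrace_twist_ac0 (s t u : 'I_N) i j : t = 0%N :> nat -> s = N.-1 :> nat ->
  \tr (twist * a (t, i) * c (u, j)) =
    (t == u)%:R * D i j - \tr (twist * a (s, i) * c (u, j)).
Proof.
move=> t0 sN; rewrite mxtrace_twist_ac (a_twist0 _ t0 sN) xpair_eqE.
by rewrite -mulnb natrM mulrA.
Qed.

(** One trip around the antiperiodic time circle determines the correlator: [step] expresses every
    value through [G t0], and the wraparound relation then fixes [G t0] up to the factor 2 kept in
    the statement. *)
Lemma mxtrace_twist_a_c (t u : 'I_N) i j :
  \tr (twist * a (t, i) * c (u, j)) *+ 2 = (if (u <= t)%N then 1 else - 1) * D i j.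
Proof.
have N_gt0 : (0 < N)%N by apply: leq_ltn_trans (ltn_ord t).
pose t0 := Ordinal N_gt0.
have lt_last : (N.-1 < N)%N by rewrite prednK.
pose last := Ordinal lt_last.
pose G s := \tr (twist * a (s, i) * c (u, j)).
(* Climbing from time 0 to [s] meets the jump at [u] only if [0 < u <= s]; a jump at [u = 0] belongs
   to the wraparound instead. *)
have step (s : 'I_N) : G s = G t0 + ((0 < u <= s)%N)%:R * D i j.
  case: s => s lt_s; elim: s lt_s => [|s IHs] lt_s.
    rewrite (_ : Ordinal lt_s = t0); last exact: val_inj.
    have -> : (0 < u <= Ordinal lt_s)%N = false by rewrite /=; lia.
    by rewrite mul0r addr0.
  rewrite {1}/G (@mxtrace_twist_acS (Ordinal (ltnW lt_s)) (Ordinal lt_s)) //.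
  rewrite -/(G _) IHs addrCA -mulrDl -natrD; congr (_ + _%:R * _).
  by rewrite -(inj_eq val_inj) /=; lia.
(* The relation from the last time back to time 0 carries the opposite sign, which turns the
   recursion into an equation for [G t0]. *)
have := @mxtrace_twist_ac0 last t0 u i j erefl erefl.
rewrite -/(G _) -/(G _) (step last) /= -(inj_eq val_inj) /= => G0.
rewrite -/(G t) step mulrnDl.
have -> : G t0 *+ 2 = ((0 == u)%N%:R - ((0 < u <= N.-1)%N)%:R) * D i j.
  by rewrite mulr2n {1}G0 mulrBl opprD addrA addrAC subrK.
rewrite -mulrnAl -mulrDl; congr (_ * _).
have -> : (u <= N.-1)%N by have := ltn_ord u; lia.
(* For [u = 0] the doubled correlator is [D] throughout; for [u > 0] it starts at [-D] and rises by
   [2 D] at time [u]. *)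
case: (nat_of_ord u) => [|v] /=; first by rewrite subr0 mul0rn addr0.
by case: ifP => _; rewrite sub0r ?mul0rn ?addr0 // mulr2n addrA addNr add0r.
Qed.

End TimeTranslation.

(** By cyclicity both orderings have the same trace, and the anticommutator fixes their sum; the
    doubled form matches that of the twisted correlator. *)
Lemma mxtrace_a_h (R : realType) (L : nat) (i j : 'I_L) :
  \tr (a_h R i *m adj (a_h R j)) *+ 2 = (i == j)%:R * (2 ^ L)%:R /\
  \tr (adj (a_h R j) *m a_h R i) = \tr (a_h R i *m adj (a_h R j)).
Proof.
split; last exact: mxtrace_mulC.
have [_ _ ac] := car_a_h R L.
rewrite mulr2n {2}mxtrace_mulC -mxtraceD [_ + _]ac mxtrace_scalar.
by rewrite mulr_natr.
Qed.

Theorem theorem1 (R : realType) (L N : nat) (eps : R) :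
  (1 <= L)%N -> (1 <= N)%N -> 0 < eps ->
  let U : 'M[R[i]]_(2 ^ (L * N)) :=
    parity R L N *m mexp ((0 +i* eps) *: Pcal L N eps) in
  [/\ \tr U = \tr (1%:M : 'M[R[i]]_(2 ^ L)),
      (forall (t1 t2 : 'I_N) (i j : 'I_L),
         \tr (U *m a_H R t1 i *m adj (a_H R t2 j)) =
           if (t2 <= t1)%N then \tr (a_h R i *m adj (a_h R j))
           else - \tr (adj (a_h R j) *m a_h R i)),
      (forall (t1 t2 : 'I_N) (i j : 'I_L),
         \tr (U *m a_H R t1 i *m a_H R t2 j) = 0) &
      (forall (t1 t2 : 'I_N) (i j : 'I_L),
         \tr (U *m adj (a_H R t1 i) *m adj (a_H R t2 j)) = 0)].
Proof.
move=> L_gt0 N_gt0 eps_gt0; rewrite /= (twistE _ _ eps_gt0); split.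
- by rewrite mxtrace_twist // mxtrace1.
- move=> t u i j; have [trh ->] := mxtrace_a_h R i j.
  (* Both sides are known only after doubling, which is injective in characteristic 0. *)
  have inj2 : injective (fun x : R[i] => x *+ 2) 
    by move=> x y /eqP; rewrite -subr_eq0 -mulrnBl mulrn_eq0 subr_eq0 => /eqP.
  apply: inj2; apply: etrans (mxtrace_twist_a_c R t u i j) _; rewrite mxtrace_twist //.
  by case: ifP => _; rewrite ?mulNrn trh ?mul1r ?mulN1r.
- by move=> t u i j; exact: (@mxtrace_twist_a2 R L N (t, i) (u, j)).
- by move=> t u i j; exact: (@mxtrace_twist_c2 R L N (t, i) (u, j)).
Qed.
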